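(* Let $n,d$ be positive integers with $d>1$ and $d<\frac{n-1}{2}$. Let $g:=\gcd(n,d)$ and $h:=\gcd(n,d+1)$. Then the multiplicity of $-2$ as an eigenvalue of $C_n^{(d)}$ is $$\begin{cases} h-1 & \text{if } \operatorname{ord}_2(d)\ge \operatorname{ord}_2(n),\\ g+h-1 & \text{if } \operatorname{ord}_2(d)<\operatorname{ord}_2(n)\text{ and } 2\mid d,\\ g+h-2 & \text{if } 2\mid n\text{ and } 2\nmid d,\end{cases}$$ where multiplicity $0$ means that $-2$ is not an eigenvalue.
   Context: $C_n$ denotes the circuit (cycle) graph on $n$ vertices. For a graph $G$ and a positive integer $d$, the $d$-th distance power $G^{(d)}$ is the graph obtained from $G$ by adding edges between all pairs of distinct vertices whose distance in $G$ is at most $d$. The eigenvalues of a graph, and their multiplicities, are those of its adjacency matrix. For a prime $p$ and a positive integer $m$, $\operatorname{ord}_p(m)=\max\{j\in\mathbb{N}_0 : p^j\mid m\}$. The condition $d<\frac{n-1}{2}$ expresses that $C_n^{(d)}$ is non-complete. *)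

(* Defs.v *)
From mathcomp Require Import all_boot all_order all_algebra.
From mathcomp Require Import reals.

Set Implicit Arguments.
Unset Strict Implicit.
Unset Printing Implicit Defensive.

Import GRing.Theory.

(* A simple graph on a finite vertex type is its (symmetric, irreflexive)
   adjacency relation. *)

Section Distance.
Variables (T : finType) (e : rel T).

Definition has_walk (x y : T) (k : nat) : bool :=
  [exists p : k.-tuple T, path e x p && (last x p == y)].

(* When y is reachable from x, a shortest walk has fewer than #|T| edges, so the
   search below finds its length.  When y is unreachable the search returns the
   junk value #|T|, standing for an infinite distance; reachability is therefore
   tested separately wherever gdist is used. *)
Definition gdist (x y : T) : nat := find (has_walk x y) (iota 0 #|T|).

Definition dist_power (d : nat) : rel T :=
  [rel x y | e x y || [&& x != y, connect e x y & gdist x y <= d]].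

Lemma gdistP (x y : T) (d : nat) :
  reflect (exists2 p, path e x p & last x p = y /\ size p <= d)
          (connect e x y && (gdist x y <= d)).
Proof.
apply: (iffP andP) => [[/connectP[p0 p0P y_p0] le_d]|[p pP [yp le_pd]]].
  have hasw : has (has_walk x y) (iota 0 #|T|).
    case/shortenP: p0P y_p0 => p pP up _ y_p.
    apply/hasP; exists (size p).
      rewrite mem_iota add0n /=.
      by move/card_uniqP: up => /= <-; exact: max_card.
    by apply/existsP; exists (in_tuple p); rewrite pP -y_p eqxx.
  have := nth_find 0 hasw.
  rewrite nth_iota ?add0n; last by rewrite has_find size_iota in hasw.
  case/existsP=> p /andP[pP /eqP yp].
  by exists (tval p) => //; rewrite size_tuple.
split; first by apply/connectP; exists p.
case: (ltnP (size p) #|T|) => [lt_p|le_p]; last first.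
  apply: leq_trans le_pd; apply: leq_trans le_p.
  by rewrite -[X in _ <= X](size_iota 0 #|T|) find_size.
apply: leq_trans le_pd; rewrite leqNgt; apply/negP => /(before_find 0).
rewrite nth_iota // add0n => /existsP[]; exists (in_tuple p).
by rewrite pP yp eqxx.
Qed.

End Distance.

(* ordS i is i + 1 modulo n.  This is the simple graph C_n for n >= 3; the
   condition i != j only matters for n = 1, where ordS has a fixed point. *)
Definition cycle_graph (n : nat) : rel 'I_n :=
  [rel i j | (i != j) && ((j == ordS i) || (i == ordS j))].

Definition adj_mx (R : nzRingType) (n : nat) (e : rel 'I_n) : 'M[R]_n :=
  (\matrix_(i, j) (e i j)%:R)%R.

(* Algebraic multiplicity.  For real symmetric A it coincides with the dimension
   of the eigenspace. *)
Definition eigen_mult (F : fieldType) (n : nat) (A : 'M[F]_n) (a : F) : nat :=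
  mup a (char_poly A).

Lemma eigen_mult_eq0 (F : fieldType) (n : nat) (A : 'M[F]_n) (a : F) :
  (eigen_mult A a == 0) = ~~ eigenvalue A a.
Proof.
rewrite eigenvalue_root_char -dvdp_XsubCl -[('X - _)%R]expr1.
by rewrite -mup_geq ?monic_neq0 ?char_poly_monic // -ltnNge ltnS leqn0.
Qed.

(* Main.v *)
Require Import Defs.
From mathcomp Require Import all_boot all_order all_algebra all_field.
From mathcomp Require Import reals.
From mathcomp Require Import zify ring lra.

(** The adjacency matrix [A] of the [d]-th power of the [n]-cycle is circulant:
    when [2d < n], [A + I] has a one in position [(i, j)] exactly when [j] is one
    of [i - d, ..., i + d] modulo [n] ([cycle_gdist_le]).  Hence, for a primitive
    [n]-th root of unity [w], the Fourier vectors [(z ^+ j)_j] with [z = w ^+ l]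
    diagonalise [A], with eigenvalues
      [eigval d z = (z ^+ -d + ... + z ^+ d) - 1],
    and the multiplicity of -2 is the number of [n]-th roots of unity [z] such
    that [eigval d z = -2].

    The value [z = 1] gives the eigenvalue [2d], which is not -2.  For [z != 1],
    multiplying [eigval d z + 2 = 0] by [z ^+ d * (z - 1)] turns the geometric
    sum into
      [z ^+ (2d + 1) - 1 + (z - 1) * z ^+ d = (z ^+ (d + 1) - 1) * (z ^+ d + 1)],
    so -2 is attained exactly when [z ^+ (d + 1) = 1] or [z ^+ d = - 1]
    ([eigval_eqN2]).

    It remains to count ([card_eigvalN2_set]).  Among the [n]-th roots of unity,
    [gcdn n m] satisfy [z ^+ m = 1]; for [m = d + 1] one of them is [z = 1] and
    has to be discarded.  The solutions of [z ^+ d = - 1] are those of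
    [z ^+ (2d) = 1] that do not satisfy [z ^+ d = 1]; there are
    [gcdn n (2d) - gcdn n d] of them, which is [gcdn n d] or [0] according to
    whether [n] has more factors 2 than [d].  Both equations hold together only
    for [z = - 1], which happens when [n] is even and [d] is odd; this accounts
    for the last case of the theorem.

    The Fourier vectors need complex numbers, whereas the theorem is about a
    real matrix.  Since the matrix has rational entries and multiplicities are
    unchanged by field embeddings ([eigen_mult_map]), the computation is made
    over the algebraic numbers and transferred through the rationals. *)

Set Implicit Arguments.
Unset Strict Implicit.
Unset Printing Implicit Defensive.
Import GRing.Theory Num.Theory.

(** * Counting roots of unity *)

Lemma gcdn_double n d : 0 < n -> 0 < d ->
  gcdn n d.*2 = gcdn n d * (if logn 2 d < logn 2 n then 2 else 1).
Proof.
move=> n_gt0 d_gt0; apply: eqn_from_log.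
- by rewrite gcdn_gt0 n_gt0.
- by rewrite muln_gt0 gcdn_gt0 n_gt0; case: ifP.
move=> p; rewrite -muln2 [in RHS]lognM ?gcdn_gt0 ?n_gt0 //; last by case: ifP.
rewrite !logn_gcd ?muln_gt0 ?d_gt0 // lognM //.
rewrite (fun_if (logn p)) logn1 (@logn_prime _ 2) //.
by have [->|_] := eqVneq p 2; case: ifP; rewrite /=; lia.
Qed.

Lemma sum_dvdn q m : 0 < q -> \sum_(i < m * q) (q %| i) = m.
Proof.
move=> q_gt0; rewrite -[RHS](mulnK m q_gt0) divn_count_dvd.
have: q %| m * q by rewrite dvdn_mull.
rewrite -(big_mkord xpredT (fun i => (q %| i) : nat)).
(* The two sums range over [0 .. M] and [1 .. M + 1], and both 0 and M + 1 are
   multiples of q. *)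
case: (m * q) => [|M] qM; first by rewrite !big_geq.
by rewrite big_ltn // dvdn0 [RHS]big_nat_recr //= qM addnC.
Qed.

Section RootCount.
Local Open Scope ring_scope.
Variables (F : numFieldType) (n : nat) (w : F).
Hypothesis prim_w : n.-primitive_root w.

Let n_gt0 : (0 < n)%N := prim_order_gt0 prim_w.

(** The equation [w ^+ (i * m) = 1] says that [n] divides [i * m], that is,
    that [i] is a multiple of [n %/ gcdn n m]. *)
Lemma card_root_exp_eq1 m : #|[set i : 'I_n | w ^+ (i * m) == 1]| = gcdn n m.
Proof.
set g := gcdn n m; have g_gt0 : (0 < g)%N by rewrite gcdn_gt0 n_gt0.
have Dn : n = (g * (n %/ g))%N by rewrite mulnC divnK ?dvdn_gcdl.
have Dm : m = (m %/ g * g)%N by rewrite divnK ?dvdn_gcdr.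
have q_gt0 : (0 < n %/ g)%N by rewrite divn_gt0 // dvdn_leq ?dvdn_gcdl.
rewrite -[RHS](sum_dvdn g q_gt0) -Dn -sum1dep_card big_mkcond /=.
apply: eq_bigr => i _; rewrite -(prim_order_dvd prim_w).
suff -> : (n %| i * m)%N = (n %/ g %| i)%N by case: ifP.
rewrite {1}Dn {1}Dm mulnA [(g * _)%N]mulnC dvdn_pmul2r //.
rewrite Gauss_dvdl // /coprime -(eqn_pmul2r g_gt0) mul1n muln_gcdl.
by rewrite -Dm mulnC -Dn.
Qed.

Lemma N1_neq1 : -1 != 1 :> F.
Proof. by rewrite eq_sym -addr_eq0 -[_ + _]/(2%:R) pnatr_eq0. Qed.

(** The equation [x = - 1] means that [x ^+ 2 = 1] but not [x = 1], which
    reduces the count to the previous lemma for the exponents [2d] and [d]. *)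
Lemma card_root_exp_eqN1 d : (0 < d)%N ->
  #|[set i : 'I_n | (w ^+ i) ^+ d == - 1]| =
  (if (logn 2 d < logn 2 n)%N then gcdn n d else 0)%N.
Proof.
move=> d_gt0; have := gcdn_double n_gt0 d_gt0.
rewrite -!card_root_exp_eq1 -(cardsID [set i : 'I_n | w ^+ (i * d) == 1]).
set C := [set i | w ^+ (_ * d) == 1].
set B := [set i | w ^+ (_ * d.*2) == 1].
have -> : B :&: C = C.
  apply/setIidPr/subsetP=> i; rewrite !inE -muln2 mulnA => /eqP zd.
  by rewrite exprM zd expr1n.
suff -> : B :\: C = [set i : 'I_n | (w ^+ i) ^+ d == - 1] by case: ifP; lia.
apply/setP=> i; rewrite !inE -muln2 mulnA !exprM sqrf_eq1.
have [->|_] := eqVneq ((w ^+ i) ^+ d) 1; last by [].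
by rewrite eq_sym (negPf N1_neq1).
Qed.

Lemma card_root_eqN1 : #|[set i : 'I_n | w ^+ i == - 1]| = ~~ odd n.
Proof.
have := @card_root_exp_eqN1 1 isT; rewrite gcdn1 logn1 => cN1.
rewrite (eq_card (B := [set i : 'I_n | (w ^+ i) ^+ 1 == - 1])); last first.
  by move=> i; rewrite !inE.
by rewrite cN1 -(pfactor_dvdn 1) // dvdn2; case: odd.
Qed.

Definition eigvalN2_set d := [set i : 'I_n |
  (w ^+ i != 1) && (((w ^+ i) ^+ d.+1 == 1) || ((w ^+ i) ^+ d == - 1))].

(** Inclusion-exclusion, written without subtraction.  If [z ^+ d.+1 = 1] and
    [z ^+ d = - 1] then [z = - 1], and conversely [- 1] satisfies both equations
    when [d] is odd, so the overlap is counted by [card_root_eqN1]. *)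
Lemma card_eigvalN2_set d : (0 < d)%N ->
  (#|eigvalN2_set d| + (~~ odd n && odd d) + 1 =
   gcdn n d.+1 + if logn 2 d < logn 2 n then gcdn n d else 0)%N.
Proof.
move=> d_gt0; rewrite -card_root_exp_eqN1 // -(card_root_exp_eq1 d.+1).
set A := [set i | _]; set B := [set i | _]; pose i0 := Ordinal n_gt0.
have -> : eigvalN2_set d = (A :\ i0) :|: B.
  apply/setP=> i; rewrite !inE exprM.
  have -> : (i == i0) = (w ^+ i == 1).
    rewrite -(prim_order_dvd prim_w) -val_eqE /=.
    by apply/eqP/idP => [->|]; rewrite ?dvdn0 // /dvdn modn_small // => /eqP.
  case: eqVneq => [->|] //=.
  by rewrite expr1n eq_sym (negPf N1_neq1).
have AB : (A :\ i0) :&: B =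
    if odd d then [set i : 'I_n | w ^+ i == - 1] else set0.
  apply/setP=> i; rewrite !inE exprM -val_eqE /= [(w ^+ i) ^+ d.+1]exprS.
  have [zd|zd] := eqVneq ((w ^+ i) ^+ d) (-1); last first.
    rewrite andbF; case: ifP; rewrite ?inE // => dodd; apply/esym/negbTE.
    by apply: contraNneq zd => ->; rewrite -signr_odd dodd expr1.
  rewrite andbT zd mulrN1 eqr_oppLR.
  have -> /= : val i != 0%N.
    by apply: contraNneq N1_neq1 => i_0; rewrite -zd i_0 expr0 expr1n.
  case: ifP; rewrite !inE // => deven; apply/negbTE.
  apply: contraNneq N1_neq1 => z1.
  by rewrite -zd z1 -signr_odd deven expr0.
have A0 : i0 \in A by rewrite inE mul0n expr0.
have := cardsUI (A :\ i0) B; rewrite AB (cardsD1 i0 A) A0.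
by case: (odd d); rewrite ?card_root_eqN1 ?cards0 ?andbT ?andbF => UI;
  rewrite -[RHS]addnA -UI; lia.
Qed.

End RootCount.

(** * Distances in the cycle *)

(** At least two vertices are required so that a vertex is not its own
    successor.  The vertices form the additive group of integers modulo [N]. *)
Section CycleDistance.
Local Open Scope ring_scope.
Variable n : nat.
Implicit Types x y : 'I_n.+2.
Local Notation N := n.+2.
Local Notation e := (@cycle_graph N).

Lemma inZpD a b : inZp (a + b) = inZp a + inZp b :> 'I_N.
Proof. by apply: val_inj; rewrite /= modnDm. Qed.

Lemma inZpS a : inZp a.+1 = inZp a + inZp 1 :> 'I_N.
Proof. by rewrite -(addn1 a) inZpD. Qed.

Lemma inZp0 : inZp 0 = 0 :> 'I_N.
Proof. exact: val_inj. Qed.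

Lemma cycle_graphE x y :
  e x y = (y == x + inZp 1) || (x == y + inZp 1).
Proof.
have ordSE z : ordS z = z + inZp 1 by apply: val_inj; rewrite /= modnDmr addn1.
rewrite (_ : e x y = (x != y) && ((y == ordS x) || (x == ordS y))) // !ordSE.
case: (eqVneq x y) => [<-|//]; rewrite orbb.
by rewrite -[X in X == _]addr0 (inj_eq (addrI x)).
Qed.

Lemma cycle_walk_fwd x k :
  exists2 p, path e x p & last x p = x + inZp k /\ size p = k.
Proof.
elim: k x => [|k IHk] x; first by exists [::]; rewrite ?inZp0 ?addr0.
have [p pP [lp sp]] := IHk (x + inZp 1); exists (x + inZp 1 :: p).
  by rewrite [path _ _ _]/= -/e pP cycle_graphE eqxx.
by split; rewrite /= ?sp // lp (inZpS k) -addrA [inZp 1 + _ in LHS]addrC.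
Qed.

Lemma cycle_walk_bwd x k :
  exists2 p, path e x p & last x p = x - inZp k /\ size p = k.
Proof.
elim: k x => [|k IHk] x; first by exists [::]; rewrite ?inZp0 ?subr0.
have [p pP [lp sp]] := IHk (x - inZp 1); exists (x - inZp 1 :: p).
  by rewrite [path _ _ _]/= -/e pP cycle_graphE subrK eqxx orbT.
split; rewrite /= ?sp // lp (inZpS k) -addrA -opprD.
by rewrite [inZp 1 + _ in LHS]addrC.
Qed.

(** The displacement of a walk of length at most [d] lies between [- d] and
    [d]; it is shifted by [d] so as to be recorded by a natural number. *)
Lemma cycle_walk_ball x d p : path e x p -> (size p <= d)%N ->
  exists2 k, (k <= d.*2)%N & last x p + inZp d = x + inZp k.
Proof.
elim: p x d => [|z p IHp] x [|d] //.
- by move=> _ _; exists 0%N.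
- by move=> _ _; exists d.+1 => //; lia.
rewrite [path _ _ _]/= -/e => /andP[xz pP] sp.
have [k le_k Dk] := IHp z d pP sp.
have {Dk}: last z p + inZp d.+1 = z + inZp k + inZp 1.
  by rewrite (inZpS d) addrA Dk.
move: xz; rewrite cycle_graphE [last _ _]/= => /orP[]/eqP-> ->.
  exists k.+2; first by rewrite doubleS.
  by rewrite (inZpS k.+1) (inZpS k) !addrA; congr (_ + _); apply: addrAC.
by exists k; rewrite 1?addrAC // doubleS; lia.
Qed.

Lemma cycle_gdist_le d x y : (d.*2 < N)%N ->
  connect e x y && (gdist e x y <= d)%N =
  (val (y - x + inZp d)%R < d.*2.+1)%N.
Proof.
move=> lt_dN; apply/gdistP/idP=> [[p pP [<- sp]]|lt_d].
  have [k le_k Dk] := cycle_walk_ball pP sp.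
  rewrite addrAC Dk addrAC subrr add0r /= modn_small //.
  exact: leq_ltn_trans le_k lt_dN.
move: lt_d; rewrite ltnS; set k := val _ => le_k.
have Dy : y = x + inZp k - inZp d by rewrite valZpK addrA addrK addrC subrK.
have [le_dk|lt_kd] := leqP d k.
  have [p pP [lp sp]] := cycle_walk_fwd x (k - d).
  exists p => //; split; last by rewrite sp leq_subLR addnn.
  by rewrite lp Dy -{2}(subnK le_dk) inZpD addrA addrK.
have [p pP [lp sp]] := cycle_walk_bwd x (d - k).
exists p => //; split; last by rewrite sp leq_subr.
rewrite lp Dy -{2}(subnK (ltnW lt_kd)) inZpD opprD [RHS]addrACA.
by rewrite !addrA addrK.
Qed.

Lemma dist_power_cycleE d x y : (0 < d)%N -> (d.*2 < N)%N ->
  dist_power e d x y = (x != y) && (val (y - x + inZp d)%R < d.*2.+1)%N.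
Proof.
move=> d_gt0 lt_dN; rewrite -cycle_gdist_le //.
have -> : dist_power e d x y =
    e x y || (x != y) && (connect e x y && (gdist e x y <= d)%N) by [].
case: (boolP (e x y)) => // exy; have /andP[-> _] := exy.
by apply/esym/gdistP; exists [:: y]; rewrite //= andbT.
Qed.

End CycleDistance.

(** * Algebraic multiplicities *)

Section Multiplicity.
Local Open Scope ring_scope.

Lemma char_poly_intertwine (F : fieldType) n (A D V : 'M[F]_n) :
  V \in unitmx -> A *m V = V *m D -> char_poly A = char_poly D.
Proof.
rewrite unitmxE unitfE => V_unit AV; rewrite /char_poly.
have V0 : (\det V)%:P != 0 by rewrite polyC_eq0.
apply: (mulIf V0).
rewrite -det_map_mx /= -det_mulmx [RHS]mulrC -det_mulmx; congr (\det _).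
rewrite /char_poly_mx mulmxBl mulmxBr -!map_mxM AV; congr (_ - _).
by rewrite scalar_mxC.
Qed.

Lemma eigen_mult_diag (F : fieldType) n (A V : 'M[F]_n) (m : 'I_n -> F) a :
  V \in unitmx -> A *m V = V *m diag_mx (\row_i m i) ->
  eigen_mult A a = #|[pred i | m i == a]|.
Proof.
move=> V_unit AV; rewrite /eigen_mult (char_poly_intertwine V_unit AV).
rewrite char_poly_trig ?diag_mx_is_trig //.
rewrite (eq_bigr (fun i => 'X - (m i)%:P)) => [|i _]; last first.
  by rewrite !mxE eqxx.
rewrite -big_enum -(big_map m xpredT (fun y => 'X - y%:P)) mu_prod_XsubC.
rewrite count_map cardE -size_filter /enum_mem -filter_predI.
by congr size; apply: eq_filter => i; rewrite !inE andbT.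
Qed.

(** Divisibility of polynomials over a field, here by the powers of the linear
    factor, does not depend on the field of coefficients. *)
Lemma eigen_mult_map (F K : fieldType) (f : {rmorphism F -> K})
    n (A : 'M[F]_n) a :
  eigen_mult (map_mx f A) (f a) = eigen_mult A a.
Proof.
rewrite /eigen_mult -map_char_poly.
have nz : char_poly A != 0 by rewrite monic_neq0 ?char_poly_monic.
have mup_le k : (k <= mup (f a) (map_poly f (char_poly A)))%N =
    (k <= mup a (char_poly A))%N.
  by rewrite !mup_geq ?map_poly_eq0 // -map_polyXsubC -rmorphXn dvdp_map.
by apply/eqP; rewrite eqn_leq -mup_le leqnn mup_le leqnn.
Qed.

End Multiplicity.

(** * The spectrum of the powers of the cycle *)

Section Spectrum.
Local Open Scope ring_scope.

(** The sum of the [z ^+ k] for [k] between [- d] and [d], minus one. *)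
Definition eigval (F : fieldType) (d : nat) (z : F) :=
  (\sum_(k < d.*2.+1) z ^+ k) / z ^+ d - 1.

Lemma eigval_eqN2 (F : numFieldType) d (z : F) : z != 0 ->
  (eigval d z == - 2) = (z != 1) && ((z ^+ d.+1 == 1) || (z ^+ d == - 1)).
Proof.
move=> z0; have zd0 : z ^+ d != 0 by rewrite expf_neq0.
rewrite /eigval -subr_eq0 opprK.
have -> : (\sum_(k < d.*2.+1) z ^+ k) / z ^+ d - 1 + 2 =
   (\sum_(k < d.*2.+1) z ^+ k + z ^+ d) / z ^+ d by field.
rewrite mulf_eq0 invr_eq0 (negPf zd0) orbF.
have [->|z1] := eqVneq z 1.
  rewrite (eq_bigr (fun=> 1)) => [|i _]; rewrite expr1n // sumr_const card_ord.
  by rewrite -[X in _ + X]/(1%:R) -natrD pnatr_eq0; apply/negbTE; lia.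
have z1' : z - 1 != 0 by rewrite subr_eq0.
rewrite -(inj_eq (mulfI z1')) mulr0 mulrDr -subrX1.
have -> : z ^+ d.*2.+1 - 1 + (z - 1) * z ^+ d =
    (z ^+ d.+1 - 1) * (z ^+ d + 1).
  by rewrite -addnn !exprS exprD; ring.
by rewrite mulf_eq0 subr_eq0 addr_eq0.
Qed.

Lemma adj_cycle_eigvec (F : fieldType) n d (z : F) (i : 'I_n.+2) :
  (0 < d)%N -> (d.*2 < n.+2)%N -> z ^+ n.+2 = 1 ->
  \sum_(j < n.+2) adj_mx F (dist_power (@cycle_graph n.+2) d) i j * z ^+ j =
  z ^+ i * eigval d z.
Proof.
set N := n.+2; move=> d_gt0 lt_dN zN; have z0 : z != 0.
  by apply/eqP=> z0; move/eqP: zN; rewrite z0 expr0n /= eq_sym oner_eq0.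
have zd0 : z ^+ d != 0 by rewrite expf_neq0.
have zmod k : z ^+ (k %% N) = z ^+ k.
  by rewrite {2}(divn_eq k N) exprD mulnC exprM zN expr1n mul1r.
have zD (x y : 'I_N) : z ^+ (x + y)%R = z ^+ x * z ^+ y.
  by rewrite /= zmod exprD.
pose B (j : 'I_N) := (val (j - i + inZp d)%R < d.*2.+1)%N.
have -> : \sum_(j < N) adj_mx F (dist_power (@cycle_graph N) d) i j * z ^+ j =
    (\sum_(j < N | B j) z ^+ j) - z ^+ i.
  have Bi : B i by rewrite /B subrr add0r /= modn_small; lia.
  rewrite (bigD1 i Bi) /= addrC addrK (bigID B) /= [X in _ + X]big1 ?addr0.
    rewrite [LHS](bigD1 i Bi) /= mxE dist_power_cycleE // eqxx mul0r add0r.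
    apply: eq_bigr => j /andP[Bj ij].
    by rewrite mxE dist_power_cycleE // eq_sym ij -/(B j) Bj mul1r.
  move=> j /negbTE Bj; rewrite mxE dist_power_cycleE // -/(B j) Bj andbF.
  by rewrite mul0r.
rewrite /eigval mulrBr mulr1; congr (_ - _).
apply: (mulIf zd0); rewrite -mulrA divfK //.
(* The translation by [i - d] maps the interval [0 .. 2d] onto [B]. *)
rewrite (reindex_inj (addrI (i - inZp d))) mulr_suml mulr_sumr.
have lt_dN' : (d.*2.+1 <= N)%N by [].
rewrite [RHS](eq_bigr (fun k => z ^+ i * z ^+ (widen_ord lt_dN' k))) //.
rewrite -(big_ord_narrow_cond (P := xpredT)
  (F := fun k : 'I_N => z ^+ i * z ^+ k) lt_dN').
apply: eq_big => [j|j _].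
  rewrite /B [X in val X](_ : _ = j) //.
  by rewrite [_ + j]addrC addrA [X in X + _]addrAC addrK subrK.
have -> : z ^+ d = z ^+ (inZp d : 'I_N) by rewrite /= zmod.
by rewrite -!zD; congr (_ ^+ _); rewrite addrAC subrK.
Qed.

(** The Fourier vectors are the columns of the Vandermonde matrix of the powers
    of [w], which is invertible because these powers are pairwise distinct. *)
Lemma eigen_mult_cycle_power (F : numFieldType) n d (w : F) :
  (0 < d)%N -> (d.*2 < n.+2)%N -> n.+2.-primitive_root w ->
  eigen_mult (adj_mx F (dist_power (@cycle_graph n.+2) d)) (- 2) =
  #|eigvalN2_set n.+2 w d|.
Proof.
move=> d_gt0 lt_dN prim_w.
pose V : 'M[F]_n.+2 := Vandermonde n.+2 (\row_l w ^+ l).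
have w0 : w != 0.
  apply: contra_eq_neq (prim_expr_order prim_w) => ->.
  by rewrite expr0n eq_sym oner_neq0.
rewrite (@eigen_mult_diag _ _ _ V (fun l => eigval d (w ^+ l))).
- by apply: eq_card => l; rewrite !inE eigval_eqN2 ?expf_neq0.
- rewrite unitmxE unitfE det_Vandermonde; apply/prodf_neq0 => i _.
  apply/prodf_neq0 => j lt_ij.
  rewrite !mxE subr_eq0 (eq_prim_root_expr prim_w).
  by rewrite !modn_small // gtn_eqF.
apply/matrixP=> i l; rewrite mul_mx_diag !mxE.
rewrite -adj_cycle_eigvec // 1?exprAC ?(prim_expr_order prim_w) ?expr1n //.
by apply: eq_bigr => j _; rewrite !mxE.
Qed.

End Spectrum.

Theorem theorem7 (R : realType) (n d : nat)
    (n_gt0 : (0 < n)%N) (d_gt1 : (1 < d)%N)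
    (d_lt : (d%:R < (n%:R - 1) / 2 :> R)%R)
    (g h : nat) (g_def : g = gcdn n d) (h_def : h = gcdn n d.+1) :
  let mult :=
    eigen_mult (adj_mx R (dist_power (@cycle_graph n) d)) (- 2)%R in
  [/\ (logn 2 n <= logn 2 d)%N -> mult = (h - 1)%N,
      (logn 2 d < logn 2 n)%N && (2 %| d)%N -> mult = (g + h - 1)%N
    & (2 %| n)%N && ~~ (2 %| d)%N -> mult = (g + h - 2)%N].
Proof.
have lt_dn : d.*2.+1 < n.
  by rewrite -(ltr_nat R) -addn1 natrD -muln2 natrM; lra.
have d_gt0 : 0 < d by apply: ltnW.
case: n => [|[|n]] // in n_gt0 d_lt g_def h_def lt_dn *.
have [w prim_w] := C_prim_root_exists n_gt0.
pose A (K : numFieldType) := adj_mx K (dist_power (@cycle_graph n.+2) d).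
have mapA (K : numFieldType) : A K = map_mx ratr (A rat).
  by apply/matrixP=> i j; rewrite !mxE rmorph_nat.
have N2 (K : numFieldType) : (-2 = ratr (-2) :> K)%R.
  by rewrite rmorphN rmorph_nat.
have multA (K : numFieldType) :
    eigen_mult (A K) (- 2)%R = eigen_mult (A rat) (- 2)%R.
  by rewrite [A K]mapA (N2 K) eigen_mult_map.
have multE : eigen_mult (A algC) (- 2)%R = #|eigvalN2_set n.+2 w d|.
  exact: eigen_mult_cycle_power d_gt0 (ltnW lt_dn) prim_w.
move=> mult; have {}multE : mult = #|eigvalN2_set n.+2 w d|.
  by rewrite -multE [RHS]multA; apply: multA.
have := card_eigvalN2_set prim_w d_gt0; rewrite -g_def -h_def !dvdn2.
have odd_log k : 0 < k -> odd k = (logn 2 k == 0).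
  by move=> k_gt0; rewrite -[odd k]negbK -dvdn2 (pfactor_dvdn 1) // lt0n negbK.
by rewrite !odd_log // -multE; case: ifP => log_lt card_eq; split; lia.
Qed.
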